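(* Assume $N\ge3$ and let $q>1$. Let $g_q$ be the cliff metric on $\mathrm{SU}(2^N)$, i.e. the penalty metric with penalty factors $q_1=q_2=1$ and $q_k=q$ for all $3\le k\le N$. Then $h_{*e}(W_1)=W_1$ for all $h\in\mathrm{Aut}(\mathrm{SU}(2^N),g_q)$.
   Context: Let $\sigma_0$ be the $2\times2$ identity matrix and $\sigma_1=\begin{bmatrix}0&1\\1&0\end{bmatrix}$, $\sigma_2=\begin{bmatrix}0&-i\\ i&0\end{bmatrix}$, $\sigma_3=\begin{bmatrix}1&0\\0&-1\end{bmatrix}$. Let $\mathcal I_N^0=\{0,1,2,3\}^N\setminus\{(0,\dots,0)\}$. For $I=(i_1,\dots,i_N)\in\mathcal I_N^0$ put $\tilde\sigma_I=-\sqrt{-1}\,\sigma_{i_1}\otimes\cdots\otimes\sigma_{i_N}$; these form a basis of $\mathfrak{su}(2^N)$. The weight $w(\tilde\sigma_I)$ is the number of $j$ with $i_j\ne0$, and $W_1=\mathrm{span}_{\mathbb R}\{\tilde\sigma_I\mid w(\tilde\sigma_I)=1\}$. Penalty metric: given positive numbers $q_1,\dots,q_N$ (penalty factors), it is the right invariant Riemannian metric $g$ on $\mathrm{SU}(2^N)$ with $g(\tilde\sigma_I,\tilde\sigma_J)=q_{w(\tilde\sigma_I)}\delta_{IJ}$ on $T_e\mathrm{SU}(2^N)=\mathfrak{su}(2^N)$. $\mathrm{Aut}(\mathrm{SU}(2^N),g)$ is the group of Lie group automorphisms of $\mathrm{SU}(2^N)$ that are isometries of $g$; $h_{*e}$ is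 the differential at the identity $e$. *)

(* Defs.v *)
From HB Require Import structures.
From mathcomp Require Import all_boot all_order all_algebra spectral.
From mathcomp Require Import complex mxtens.
From mathcomp Require Import all_classical all_reals all_analysis.

Set Implicit Arguments.
Unset Strict Implicit.
Unset Printing Implicit Defensive.

Import Order.TTheory GRing.Theory Num.Theory.
Import numFieldNormedType.Exports.

Local Open Scope classical_set_scope.
Local Open Scope complex_scope.
Local Open Scope sesquilinear_scope.
Local Open Scope ring_scope.

Section Smoothness.
Context {R : realType}.

(* [diff_class k U f]: on the set [U] (open in all uses), [f] is of class C^k.
   In finite dimension, asking that every x |-> 'd f x v be C^k is the same as
   asking that x |-> 'd f x be C^k. *)
Fixpoint diff_class (k : nat) (V W : normedModType R) (U : set V) (f : V -> W)
    : Prop :=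
  if k is k'.+1 then
    (forall x, U x -> differentiable f x) /\
    (forall v, diff_class k' U (fun x => 'd f x v))
  else forall x, U x -> {for x, continuous f}.

(* Smoothness of a map defined on a subset [A] of a normed space, as used for
   embedded submanifolds: near each point of [A] it extends to a C^oo map. *)
Definition smooth_on (V W : normedModType R) (A : set V) (f : V -> W) : Prop :=
  forall p, A p -> exists U : set V, exists F : V -> W,
    [/\ open U, U p, forall k, diff_class k U F &
        forall x, U x -> A x -> F x = f x].

End Smoothness.

Section SpecialUnitary.
Context {R : realType}.

Definition SU (n : nat) : set 'M[R[i]]_n :=
  [set p | p \is unitarymx /\ \det p = 1].

Definition su (n : nat) : set 'M[R[i]]_n :=
  [set X | X ^t* = - X /\ \tr X = 0].

(* [R[i]] is not a normed module over [R] in the library, so calculus over [R]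
   is done on the pair of the real and imaginary parts of a matrix. *)
Definition realify (n : nat) (X : 'M[R[i]]_n) : 'M[R]_n * 'M[R]_n :=
  (map_mx (@complex.Re R) X, map_mx (@complex.Im R) X).

Definition complexify (n : nat) (z : 'M[R]_n * 'M[R]_n) : 'M[R[i]]_n :=
  \matrix_(a, b) (z.1 a b +i* z.2 a b).

(* Maps and fields on SU(n) are represented by total functions on matrices, of
   which only the values on SU(n) are ever constrained. *)
Definition smooth_SU (W : normedModType R) (n : nat) (f : 'M[R[i]]_n -> W)
    : Prop :=
  smooth_on [set z | SU (complexify z)] (fun z => f (complexify z)).

(* Right translation by [p] maps T_e SU(n) = su(n) onto T_p SU(n). *)
Definition tangent_space (n : nat) (p : 'M[R[i]]_n) : set 'M[R[i]]_n :=
  [set X *m p | X in @su n].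

Definition curve_with_velocity (n : nat) (p u : 'M[R[i]]_n)
    (c : R -> 'M[R[i]]_n) : Prop :=
  [/\ forall t, SU (c t), c 0 = p &
      is_derive (0 : R) (1 : R) (fun t => realify (c t)) (realify u)].

(* h_{*p}(u): the common velocity at 0 of the curves h o c, for c ranging over
   the curves in SU(n) through p with velocity u. It is well defined when h is
   smooth and u is tangent at p; the default value 0 is irrelevant. *)
Definition differential (n : nat) (h : 'M[R[i]]_n -> 'M[R[i]]_n)
    (p u : 'M[R[i]]_n) : 'M[R[i]]_n :=
  xget 0 [set w | forall c, curve_with_velocity p u c ->
    is_derive (0 : R) (1 : R) (fun t => realify (h (c t))) (realify w)].

Definition smooth_vector_field (n : nat) (V : 'M[R[i]]_n -> 'M[R[i]]_n)
    : Prop :=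
  (forall p, SU p -> tangent_space p (V p)) /\
  smooth_SU (fun p => realify (V p)).

(* [g p u v] stands for g_p(u, v), with u and v tangent at p. *)
Record riemannian_metric (n : nat)
    (g : 'M[R[i]]_n -> 'M[R[i]]_n -> 'M[R[i]]_n -> R) : Prop := {
  metric_sym : forall p u v, SU p -> tangent_space p u -> tangent_space p v ->
    g p u v = g p v u;
  metric_linear : forall p (a : R) u u' v, SU p ->
    tangent_space p u -> tangent_space p u' -> tangent_space p v ->
    g p (a%:C *: u + u') v = a * g p u v + g p u' v;
  metric_pos : forall p u, SU p -> tangent_space p u -> u != 0 ->
    0 < g p u u;
  metric_smooth : forall V W, smooth_vector_field V -> smooth_vector_field W ->
    smooth_SU (fun p => g p (V p) (W p) : R)
}.

Definition right_invariant (n : nat)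
    (g : 'M[R[i]]_n -> 'M[R[i]]_n -> 'M[R[i]]_n -> R) : Prop :=
  forall k p u v, SU k -> SU p -> tangent_space p u -> tangent_space p v ->
    g (p *m k) (u *m k) (v *m k) = g p u v.

Definition lie_group_automorphism (n : nat) (h : 'M[R[i]]_n -> 'M[R[i]]_n)
    : Prop :=
  [/\ forall p, SU p -> SU (h p),
      forall p p', SU p -> SU p' -> h (p *m p') = h p *m h p',
      smooth_SU (fun p => realify (h p)) &
      exists h' : 'M[R[i]]_n -> 'M[R[i]]_n,
        [/\ forall p, SU p -> SU (h' p),
            forall p, SU p -> h' (h p) = p,
            forall p, SU p -> h (h' p) = p &
            smooth_SU (fun p => realify (h' p))]].

(* For diffeomorphisms of SU(n). *)
Definition riemannian_isometry (n : nat)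
    (g : 'M[R[i]]_n -> 'M[R[i]]_n -> 'M[R[i]]_n -> R)
    (h : 'M[R[i]]_n -> 'M[R[i]]_n) : Prop :=
  forall p u v, SU p -> tangent_space p u -> tangent_space p v ->
    g (h p) (differential h p u) (differential h p v) = g p u v.

Definition Aut_SU (n : nat) (g : 'M[R[i]]_n -> 'M[R[i]]_n -> 'M[R[i]]_n -> R)
    : set ('M[R[i]]_n -> 'M[R[i]]_n) :=
  [set h | lie_group_automorphism h /\ riemannian_isometry g h].

End SpecialUnitary.

Section Pauli.
Context {R : realType}.

Definition mx2 (a b c d : R[i]) : 'M[R[i]]_2 :=
  \matrix_(r < 2, s < 2)
    if r == 0 then (if s == 0 then a else b) else (if s == 0 then c else d).

Definition pauli (k : 'I_4) : 'M[R[i]]_2 :=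
  match val k with
  | 0 => 1%:M
  | 1 => mx2 0 1 1 0
  | 2 => mx2 0 (- 'i%C) 'i%C 0
  | _ => mx2 1 0 0 (- 1)
  end.

(* sigma_(i_1) (x) ... (x) sigma_(i_N), associated to the right. *)
Fixpoint pauli_tensor (N : nat) : ('I_N -> 'I_4) -> 'M[R[i]]_(2 ^ N) :=
  match N with
  | 0 => fun _ => 1%:M
  | N'.+1 => fun I => castmx (esym (expnS 2 N'), esym (expnS 2 N'))
      (tensmx (pauli (I ord0)) (pauli_tensor (fun j => I (lift ord0 j))))
  end.

Definition sigma_tilde (N : nat) (I : {ffun 'I_N -> 'I_4})
    : 'M[R[i]]_(2 ^ N) := - 'i%C *: pauli_tensor I.

Definition multi_index0 (N : nat) : {set {ffun 'I_N -> 'I_4}} :=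
  [set~ [ffun => ord0]].

Definition weight (N : nat) (I : {ffun 'I_N -> 'I_4}) : nat :=
  #|[set j | I j != ord0]|.

Definition W1 (N : nat) : set 'M[R[i]]_(2 ^ N) :=
  [set X | exists a : {ffun 'I_N -> 'I_4} -> R,
    X = \sum_(I in multi_index0 N | weight I == 1%N)
          (a I)%:C *: sigma_tilde I].

(* The penalty factor q_k is [q k]; only 1 <= k <= N matters. *)
Definition penalty_metric (N : nat) (q : nat -> R)
    (g : 'M[R[i]]_(2 ^ N) -> 'M[R[i]]_(2 ^ N) -> 'M[R[i]]_(2 ^ N) -> R)
    : Prop :=
  [/\ forall k, (1 <= k <= N)%N -> 0 < q k,
      riemannian_metric g, right_invariant g &
      forall I J, I \in multi_index0 N -> J \in multi_index0 N ->
        g 1%:M (sigma_tilde I) (sigma_tilde J) =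
        if I == J then q (weight I) else 0].

Definition cliff_factors (q : R) (k : nat) : R := if (k <= 2)%N then 1 else q.

Definition cliff_metric (N : nat) (q : R)
    (g : 'M[R[i]]_(2 ^ N) -> 'M[R[i]]_(2 ^ N) -> 'M[R[i]]_(2 ^ N) -> R)
    : Prop :=
  penalty_metric (cliff_factors q) g.

End Pauli.

(* Main.v *)
Require Import Defs.
From mathcomp Require Import all_boot all_order all_algebra spectral.
From mathcomp Require Import complex mxtens.
From mathcomp Require Import all_classical all_reals all_analysis.
From mathcomp Require Import ring lra.

Set Implicit Arguments.
Unset Strict Implicit.
Unset Printing Implicit Defensive.

Import Order.TTheory GRing.Theory Num.Theory.
Import numFieldNormedType.Exports.

Local Open Scope classical_set_scope.
Local Open Scope complex_scope.
Local Open Scope sesquilinear_scope.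
Local Open Scope ring_scope.

(** Write s_K for the Pauli basis of su(2^N), D for the differential of the
    automorphism h at the identity, and g for the cliff metric at the identity.

    D is a bijective real-linear map of su(2^N) which preserves brackets and g.
    It therefore commutes with every operator built from the bracket and g
    alone, in particular with the Casimir operator of g,
      L X = \sum_K g(s_K, s_K)^-1 [s_K, [s_K, X]],
    which by Parseval is the same for every g-orthogonal basis
    ([casimir_independent], [casimir_differential]).

    The s_J are eigenvectors of L: [s_K, [s_K, s_J]] is -4 s_J if s_K and s_J
    anticommute and 0 otherwise ([double_bracket_sigma_tilde]). The eigenvalue
    is thus -4 times the number of K anticommuting with J, those of weight
    above 2 being counted with the factor 1/q. Half of the 4^N indices
    anticommute with J, and so do 2 w (3N - 2w) of the indices of weight at
    most 2, where w is the weight of J; a generating function gives the second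
    count. Since q <> 1, the eigenvalue determines w (3N - 2w)
    ([casimir_eigenvalueE]). The equation w (3N - 2w) = 3N - 2 has the roots
    w = 1 and w = 3N/2 - 1, and the second one exceeds N as soon as N >= 3.
    Hence W_1 is precisely the eigenspace of L for this eigenvalue
    ([W1_eigenspaceP]), so D maps it into itself, and onto itself because D is
    bijective.

    The facts about D rest on curves in SU(2^N). A product of factors
    cos (x t) + sin (x t) s_K runs in SU(2^N) through the identity, and such
    products realise every velocity in su(2^N) ([su_curve]). A local smooth
    extension of h yields a real-linear map that sends the velocity of a curve
    to the velocity of its image ([smooth_SU_linearization]); differentiating
    p X p^-1 along a curve then gives the compatibility of D with brackets.
    That D X is traceless comes from su(2^N) being spanned by brackets. *)

(** * Tensor products of 2 x 2 matrices and Pauli matrices *)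

Section PauliAlgebra.
Context {R : realType}.

(** [pauli_tensor] with arbitrary factors, so that products and adjoints of Pauli
    tensors are again of this form. *)
Fixpoint tensor (N : nat) : ('I_N -> 'M[R[i]]_2) -> 'M[R[i]]_(2 ^ N) :=
  match N with
  | 0 => fun _ => 1%:M
  | N'.+1 => fun A => castmx (esym (expnS 2 N'), esym (expnS 2 N'))
      (tensmx (A ord0) (tensor (fun j => A (lift ord0 j))))
  end.

Lemma pauli_tensorE N (I : 'I_N -> 'I_4) :
  pauli_tensor I = tensor (fun j => pauli (I j)) :> 'M[R[i]]__.
Proof. by elim: N I => [//|N IH] I /=; rewrite IH. Qed.

(** The binary digits of a row index of a tensor power: the [j]-th one selects
    the row in the [j]-th factor. *)
Fixpoint bit (N : nat) : 'I_(2 ^ N) -> 'I_N -> 'I_2 :=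
  match N with
  | 0 => fun _ _ => ord0
  | N'.+1 => fun a j =>
      let u := mxtens_unindex (cast_ord (expnS 2 N') a) in
      if unlift ord0 j is Some j' then bit u.2 j' else u.1
  end.

(** All computations with tensor products go through this entrywise formula:
    it turns sums over indices into products of sums, factor by factor. *)
Lemma tensorE N (A : 'I_N -> 'M[R[i]]_2) a b :
  tensor A a b = \prod_j A j (bit a j) (bit b j).
Proof.
elim: N A a b => [|N IH] A a b /=.
  by rewrite big_ord0 mxE !(ord1 (_ : 'I_(2 ^ 0))) eqxx.
rewrite castmxE !mxE /= big_ord_recl unlift_none IH.
rewrite (eq_irrelevance (esym (esym _)) (expnS 2 N)).
by congr (_ * _); apply: eq_bigr => j _; rewrite liftK.
Qed.

Lemma bit_inj N : injective (fun a : 'I_(2 ^ N) => [ffun j => bit a j]).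
Proof.
elim: N => [|N IH] a b; first by rewrite !(ord1 (_ : 'I_(2 ^ 0))).
move=> /ffunP e; apply: (@cast_ord_inj _ _ (expnS 2 N)).
rewrite -[LHS]mxtens_unindexK -[RHS]mxtens_unindexK; congr mxtens_index.
rewrite [LHS]surjective_pairing [RHS]surjective_pairing; congr pair.
  by have := e ord0; rewrite !ffunE /= unlift_none.
apply: IH; apply/ffunP => j; have := e (lift ord0 j).
by rewrite !ffunE /= liftK.
Qed.

Lemma bit_bij N : bijective (fun a : 'I_(2 ^ N) => [ffun j => bit a j]).
Proof. by apply: inj_card_bij (@bit_inj N) _; rewrite card_ffun !card_ord. Qed.

Lemma prod_bit_eq N (a b : 'I_(2 ^ N)) :
  \prod_j ((bit a j == bit b j)%:R : R[i]) = (a == b)%:R.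
Proof.
have [->|ab] := eqVneq; first by rewrite big1 // => j _; rewrite eqxx.
have /forallPn[j jP] : ~~ [forall j, bit a j == bit b j].
  apply: contra ab => /forallP e; apply/eqP/bit_inj/ffunP => j.
  by rewrite !ffunE; apply/eqP.
by rewrite (bigD1 j) //= (negbTE jP) mul0r.
Qed.

Lemma tensor1 N : tensor (fun _ : 'I_N => 1%:M) = 1%:M.
Proof.
apply/matrixP => a b; rewrite tensorE mxE -prod_bit_eq.
by apply: eq_bigr => j _; rewrite mxE.
Qed.

Lemma tensorM N (A B : 'I_N -> 'M[R[i]]_2) :
  tensor A *m tensor B = tensor (fun j => A j *m B j).
Proof.
apply/matrixP => a b; rewrite tensorE !mxE.
under [RHS]eq_bigr do rewrite mxE.
rewrite bigA_distr_bigA (reindex _ (onW_bij _ (bit_bij N))) /=.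
apply: eq_bigr => c _; rewrite !tensorE -big_split.
by apply: eq_bigr => j _ /=; rewrite !ffunE.
Qed.

Lemma tensorZ N (c : 'I_N -> R[i]) (A : 'I_N -> 'M[R[i]]_2) :
  tensor (fun j => c j *: A j) = (\prod_j c j) *: tensor A.
Proof.
apply/matrixP => a b; rewrite mxE !tensorE -big_split /=.
by apply: eq_bigr => j _; rewrite mxE.
Qed.

Lemma tensor_adj N (A : 'I_N -> 'M[R[i]]_2) :
  (tensor A) ^t* = tensor (fun j => (A j) ^t*).
Proof.
apply/matrixP => a b; rewrite 2!mxE !tensorE rmorph_prod /=.
by apply: eq_bigr => j _; rewrite 2!mxE.
Qed.

Lemma eq_tensor N (A B : 'I_N -> 'M[R[i]]_2) : A =1 B -> tensor A = tensor B.
Proof. by move=> /funext ->. Qed.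

(** Two Pauli matrices anticommute exactly when they are distinct and both
    different from the identity. *)
Definition pauli_sign (k l : 'I_4) : R :=
  if [|| k == ord0, l == ord0 | k == l] then 1 else -1.

Ltac four k := case: k => -[|[|[|[|//]]]] ?.

Ltac mx2_crush :=
  apply/matrixP; case=> -[|[|//]] ?; case=> -[|[|//]] ?;
  rewrite ?(mxE, big_ord_recl, big_ord0) /=; apply/eqP;
  rewrite eq_complex /=; apply/andP; split; apply/eqP; ring.

Lemma pauli_comm k l :
  pauli k *m pauli l = (pauli_sign k l)%:C *: (pauli l *m pauli k).
Proof.
by four k; four l; rewrite /pauli /pauli_sign -?val_eqE /=; mx2_crush.
Qed.

Lemma pauli_sqr k : pauli k *m pauli k = 1%:M :> 'M[R[i]]_2.
Proof. by four k; rewrite /pauli /=; mx2_crush. Qed.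

Lemma pauli_adj k : (pauli k) ^t* = pauli k :> 'M[R[i]]_2.
Proof. by four k; rewrite /pauli /=; mx2_crush. Qed.

(** Completeness of the Pauli basis of the 2 x 2 matrices, in coordinates. *)
Lemma pauli_complete a b c d :
  \sum_k pauli k a b * pauli k c d = (2 * (a == d)%:R) * (b == c)%:R :> R[i].
Proof.
rewrite !big_ord_recl big_ord0 /pauli /=.
by case: a => -[|[|//]] ?; case: b => -[|[|//]] ?;
 case: c => -[|[|//]] ?; case: d => -[|[|//]] ?;
  rewrite ?mxE /=; apply/eqP; rewrite eq_complex /=; apply/andP; split; apply/eqP; ring.
Qed.

End PauliAlgebra.

(** * The Pauli basis of su(2^N) *)

Section SigmaTilde.
Context {R : realType}.
Variable N : nat.
Implicit Types I J K : {ffun 'I_N -> 'I_4}.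
Local Notation st := (@sigma_tilde R N).

Definition index_sign I J : R := \prod_j pauli_sign (I j) (J j).

Lemma sigma_tilde_comm I J :
  st I *m st J = (index_sign I J)%:C *: (st J *m st I).
Proof.
rewrite /sigma_tilde !pauli_tensorE -!scalemxAl -!scalemxAr !tensorM.
rewrite (eq_tensor (fun j => pauli_comm (I j) (J j))) tensorZ -rmorph_prod.
by rewrite !scalerA; congr (_ *: _); ring.
Qed.

Lemma sigma_tilde_sqr I : st I *m st I = - 1%:M.
Proof.
rewrite /sigma_tilde !pauli_tensorE -!scalemxAl -!scalemxAr tensorM.
rewrite (eq_tensor (fun j => pauli_sqr (I j))) tensor1 scalerA.
by rewrite mulrNN -expr2 sqr_i scaleN1r.
Qed.

Lemma sigma_tilde_adj I : (st I) ^t* = - st I.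
Proof.
rewrite /sigma_tilde !pauli_tensorE linearZ /= map_mxZ tensor_adj.
rewrite (eq_tensor (fun j => pauli_adj (I j))) -scaleNr; congr (_ *: _).
by apply/eqP; rewrite eq_complex /= !oppr0 !eqxx.
Qed.

Lemma sigma_tilde_complete a b c d :
  \sum_I st I a b * st I c d = - ((2 ^+ N * (a == d)%:R) * (b == c)%:R).
Proof.
under eq_bigr => I _ do
  rewrite !mxE mulrACA mulrNN -expr2 sqr_i !pauli_tensorE !tensorE -big_split /= mulN1r.
rewrite sumrN; congr (- _).
rewrite -(bigA_distr_bigA (fun j k =>
  pauli k (bit a j) (bit b j) * pauli k (bit c j) (bit d j))).
under eq_bigr do rewrite pauli_complete.
rewrite !big_split /= !prod_bit_eq; congr (_ * _ * _).
by rewrite prodr_const card_ord.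
Qed.

Lemma index_signC I J : index_sign I J = index_sign J I.
Proof.
by apply: eq_bigr => j _; rewrite /pauli_sign orbCA [I j == J j]eq_sym.
Qed.

(** At a position where [I] is nontrivial, two of the three nontrivial Pauli
    matrices anticommute with the factor of [I]; placing one of them there and
    the identity elsewhere gives [J]. *)
Lemma anticommuting_partner I : I \in multi_index0 N ->
  exists2 J, J \in multi_index0 N & index_sign I J = -1.
Proof.
rewrite !inE => /eqP I0.
have [j Ij] : exists j, I j != ord0.
  apply/existsP; apply: contra_notT I0 => /existsPn e.
  by apply/ffunP => j; rewrite ffunE; apply/eqP; have := e j; rewrite negbK.
have [k] : exists k : 'I_4, (k != ord0) && (k != I j).
  have [->|I1] := eqVneq (I j) (inord 1).
    by exists (inord 2); rewrite -!val_eqE /= !inordK.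
  by exists (inord 1); rewrite (eq_sym _ (I j)) I1 -val_eqE /= inordK.
case/andP=> k0 kI; exists [ffun j' => if j' == j then k else ord0].
  by rewrite !inE; apply: contraNneq k0 => /ffunP/(_ j); rewrite !ffunE eqxx => ->.
rewrite /index_sign (bigD1 j) //= big1 => [|j' /negbTE jj'].
  by rewrite ffunE eqxx mulr1 /pauli_sign (negbTE Ij) (negbTE k0) eq_sym (negbTE kI).
by rewrite ffunE jj' /pauli_sign eqxx orbT.
Qed.

(** Conjugation by an anticommuting partner sends the matrix to its opposite
    but keeps its trace. *)
Lemma sigma_tilde_tr I : I \in multi_index0 N -> \tr (st I) = 0.
Proof.
move=> /anticommuting_partner[J _ IJ].
have e : \tr (st J *m (st I *m st J)) = \tr (st I *m st J *m st J).
  by rewrite mxtrace_mulC.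
move: e; rewrite {1}sigma_tilde_comm IJ -scalemxAr mulmxA sigma_tilde_sqr.
rewrite -mulmxA sigma_tilde_sqr mulmxN mulNmx mul1mx mulmx1 mxtraceZ !raddfN /=.
rewrite rmorph1 mulN1r opprK => /eqP; rewrite -subr_eq0 opprK -mulr2n mulrn_eq0 /=.
by move/eqP.
Qed.

Lemma su_sigma_tilde I : I \in multi_index0 N -> su (st I).
Proof. by move=> I0; split; [exact: sigma_tilde_adj | exact: sigma_tilde_tr]. Qed.

(** Completeness expands [X] with coefficients proportional to
    [\tr (X *m sigma_tilde I)]; these are real because both factors are
    skew-Hermitian, and the one of the identity index is the trace of [X]. *)
Lemma su_spanned (X : 'M[R[i]]_(2 ^ N)) : su X ->
  exists x : {ffun 'I_N -> 'I_4} -> R,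
    X = \sum_(I in multi_index0 N) (x I)%:C *: st I.
Proof.
move=> [Xadj Xtr].
have tr_real I : (complex.Re (\tr (X *m st I)))%:C = \tr (X *m st I).
  apply: RRe_real; rewrite CrealE; apply/eqP.
  transitivity (\tr ((X *m st I) ^t*)); first by rewrite trace_map_mx mxtrace_tr.
  rewrite trmx_mul map_mxM /= Xadj sigma_tilde_adj mulNmx mulmxN opprK.
  exact: mxtrace_mulC.
have st0 I : I \notin multi_index0 N -> \tr (X *m st I) = 0.
  rewrite !inE negbK => /eqP ->.
  rewrite /sigma_tilde pauli_tensorE (@eq_tensor _ _ _ (fun=> 1%:M)) ?tensor1.
    by rewrite -scalemxAr mulmx1 mxtraceZ Xtr mulr0.
  by move=> j; rewrite ffunE.
exists (fun I => - (2 ^- N) * complex.Re (\tr (X *m st I))).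
under eq_bigr do rewrite rmorphM /= tr_real -scalerA.
rewrite -scaler_sumr big_mkcond /=.
rewrite (eq_bigr (fun I => \tr (X *m st I) *: st I)); last first.
  by move=> I _; case: ifPn => // /st0 ->; rewrite scale0r.
suff -> : \sum_I \tr (X *m st I) *: st I = - 2 ^+ N *: X.
  rewrite scalerA rmorphN /= mulrNN rmorphV ?unitfE ?expf_neq0 //=.
  by rewrite rmorphXn /= rmorph_nat mulVf ?scale1r // expf_neq0.
apply/matrixP => c d; rewrite summxE mxE.
transitivity (\sum_a \sum_b X a b * \sum_I st I b a * st I c d).
  under eq_bigr => I _.
    rewrite mxE /mxtrace mulr_suml.
    under eq_bigr => a _.
      rewrite mxE mulr_suml.
      under eq_bigr do rewrite -mulrA.
      over.
    over.
  rewrite exchange_big /=; apply: eq_bigr => a _.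
  rewrite exchange_big /=; apply: eq_bigr => b _.
  by rewrite mulr_sumr.
under eq_bigr do under eq_bigr do rewrite sigma_tilde_complete.
rewrite (bigD1 c) //= (bigD1 d) //= !eqxx !big1 => [|a /negbTE ac|b /negbTE bd].
- by rewrite !mulr1 !addr0 mulrN mulNr mulrC.
- by rewrite big1 // => b _; rewrite ac mulr0 oppr0 mulr0.
- by rewrite bd mulr0 mul0r oppr0 mulr0.
Qed.

End SigmaTilde.

(** * Counting anticommuting indices *)

Section Count.
Context {R : realType}.

(** The second elementary symmetric function is expressed through power sums,
    which are easy to evaluate when [c] takes only two values. *)
Lemma prod_linear_coef (T : Type) (r : seq T) (c : T -> R) :
  let p := \prod_(j <- r) (1 + c j *: 'X) in
  [/\ p`_0 = 1, p`_1 = \sum_(j <- r) c j &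
      2 * p`_2 = (\sum_(j <- r) c j) ^+ 2 - \sum_(j <- r) c j ^+ 2].
Proof.
elim: r => [|x r [IH0 IH1 IH2]] /=.
  by rewrite !big_nil !coef1 /=; split => //; ring.
rewrite !big_cons mulrDl mul1r -scalerAl !coefD !coefZ !(mulrC 'X) !coefMX /= IH0 IH1.
split; [ring|ring|].
rewrite mulrDr IH2; ring.
Qed.

Variable N : nat.
Implicit Types I J K : {ffun 'I_N -> 'I_4}.

Lemma weight_sum J : weight J = (\sum_j (J j != ord0))%N.
Proof.
rewrite /weight -sum1_card big_mkcond; apply: eq_bigr => j _.
rewrite (_ : (j \in _) = (J j != ord0)); first by case: (_ != _).
by apply/idP/idP => [/set_mem|/mem_set].
Qed.

(** The number of [k] in {1, 2, 3} commuting with [J j], minus the number of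
    those anticommuting with it. *)
Definition commutation_excess (J : {ffun 'I_N -> 'I_4}) (j : 'I_N) : R :=
  if J j == ord0 then 3 else -1.

(** The sign is a product and the weight a sum over the positions, so the
    generating function factors; its coefficients in the degrees 1 and 2 are
    values of Krawtchouk polynomials. *)
Lemma sign_generating_function J :
  \sum_K index_sign K J *: 'X^(weight K) =
  \prod_j (1 + commutation_excess J j *: 'X) :> {poly R}.
Proof.
have site j : 1 + commutation_excess J j *: 'X =
    \sum_(k : 'I_4) pauli_sign k (J j) *: 'X^(k != ord0) :> {poly R}.
  rewrite !big_ord_recl big_ord0 /commutation_excess /pauli_sign.
  case: (J j) => -[|[|[|[|//]]]] ?; rewrite -!val_eqE /= !expr0 !expr1 -!mul_polyC;
    rewrite ?polyCN; ring.
under [RHS]eq_bigr do rewrite site.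
rewrite bigA_distr_bigA /=; apply: eq_bigr => K _.
rewrite weight_sum -!mul_polyC rmorph_prod /= expr_sum -big_split /=.
by apply: eq_bigr => j _; rewrite mul_polyC.
Qed.

(** The generating function at 1 has a zero factor: exactly half of the indices
    anticommute with a nontrivial one. *)
Lemma sum_index_sign J : J \in multi_index0 N -> \sum_K index_sign K J = 0 :> R.
Proof.
rewrite !inE => /eqP J0.
have [j Jj] : exists j, J j != ord0.
  apply/existsP; apply: contra_notT J0 => /existsPn e.
  by apply/ffunP => j; rewrite ffunE; apply/eqP; have := e j; rewrite negbK.
have := congr1 (horner^~ 1) (sign_generating_function J).
rewrite horner_sum horner_prod (bigD1 j) //= {1}/commutation_excess (negbTE Jj).
rewrite !hornerE subrr mul0r => e; rewrite -[RHS]e.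
by apply: eq_bigr => K _; rewrite !hornerE expr1n mulr1.
Qed.

Lemma sum_index_sign_le2 J : let w := (weight J)%:R : R in let n := N%:R in
  2 * (\sum_(K | (weight K <= 2)%N) index_sign K J) =
  2 + 2 * (3 * n - 4 * w) + (3 * n - 4 * w) ^+ 2 - 9 * n + 8 * w.
Proof.
move=> w n.
have coefs m : \sum_(K | weight K == m) index_sign K J =
    (\prod_j (1 + commutation_excess J j *: 'X))`_m :> R.
  rewrite -sign_generating_function coef_sum big_mkcond.
  by apply: eq_bigr => K _; rewrite coefZ coefXn eq_sym; case: eqP; rewrite ?mulr1 ?mulr0.
have [p0 p1 p2] := prod_linear_coef (index_enum 'I_N) (commutation_excess J).
have wE : w = \sum_j (J j != ord0)%:R by rewrite /w weight_sum natr_sum.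
have nE : n = \sum_(j < N) 1%:R by rewrite -natr_sum sum1_card card_ord.
have e1 : \sum_j commutation_excess J j = 3 * n - 4 * w.
  rewrite wE nE !mulr_sumr -sumrB.
  by apply: eq_bigr => j _; rewrite /commutation_excess; case: eqP => _ /=; ring.
have e2 : \sum_j commutation_excess J j ^+ 2 = 9 * n - 8 * w.
  rewrite wE nE !mulr_sumr -sumrB.
  by apply: eq_bigr => j _; rewrite /commutation_excess; case: eqP => _ /=; ring.
have -> : \sum_(K | (weight K <= 2)%N) index_sign K J =
    \sum_(K | weight K == 0) index_sign K J + \sum_(K | weight K == 1) index_sign K J
    + \sum_(K | weight K == 2) index_sign K J :> R.
  rewrite !(big_mkcond (fun K => weight K == _)) -!big_split big_mkcond /=.
  by apply: eq_bigr => K _; case: (weight K) => [|[|[|m]]] /=; ring.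
by rewrite !mulrDr !coefs p2 p1 p0 e1 e2; ring.
Qed.

Variable q : R.
Hypothesis q1 : 1 < q.

(** The sign minus 1 is -2 on the anticommuting [K] and 0 on the others, so this
    is -4 times the weighted number of anticommuting indices. *)
Definition casimir_eigenvalue J : R :=
  \sum_(K in multi_index0 N) (cliff_factors q (weight K))^-1 * (2 * (index_sign K J - 1)).

(** The inverse penalty factor is [q^-1] on all indices plus [1 - q^-1] on those
    of weight at most 2. *)
Lemma casimir_eigenvalueE J : J \in multi_index0 N ->
  casimir_eigenvalue J =
    - (2 * q^-1 * #|{ffun 'I_N -> 'I_4}|%:R
       + 8 * (1 - q^-1) * ((weight J)%:R * (3 * N%:R - 2 * (weight J)%:R))).
Proof.
move=> J0; pose O : {ffun 'I_N -> 'I_4} := [ffun=> ord0].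
have O1 K : index_sign O K = 1 :> R.
  by rewrite /index_sign big1 // => j _; rewrite /pauli_sign ffunE eqxx.
(* Each sum of signs minus 1 is a difference of two sums of signs, the second
   one taken at the trivial index [O], which commutes with everything. *)
transitivity (2 * q^-1 * (\sum_K index_sign K J - \sum_(K : {ffun 'I_N -> 'I_4}) 1)
  + (1 - q^-1) * (2 * (\sum_(K | (weight K <= 2)%N) index_sign K J)
       - 2 * (\sum_(K | (weight K <= 2)%N) index_sign K O))).
  rewrite -mulrBr !(big_mkcond (fun K => (weight K <= 2)%N)).
  rewrite -!sumrB !mulr_sumr -big_split /=.
  rewrite /casimir_eigenvalue big_mkcond /=; apply: eq_bigr => K _.
  have -> : index_sign K O = 1 :> R.
    by rewrite /index_sign big1 // => j _; rewrite /pauli_sign ffunE eqxx orbT.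
  case: ifPn => [_|].
    by rewrite /cliff_factors; case: ifP => _; rewrite ?invr1; ring.
  rewrite !inE negbK => /eqP ->; rewrite O1.
  by case: ifP => _; ring.
have w0 : weight O = 0%N.
  by rewrite weight_sum big1 // => j _; rewrite ffunE eqxx.
rewrite !sum_index_sign_le2 w0 sum_index_sign // sumr_const; ring.
Qed.

(** [w (3N - 2w)] takes its value at 1 also at [w = 3N/2 - 1], but this is larger
    than [N] when [N >= 3]. *)
Lemma casimir_eigenvalue_weight1 I J : (3 <= N)%N ->
  I \in multi_index0 N -> J \in multi_index0 N -> weight J = 1%N ->
  (casimir_eigenvalue I == casimir_eigenvalue J) = (weight I == 1)%N.
Proof.
move=> N3 I0 J0 J1; rewrite !casimir_eigenvalueE // J1.
apply/eqP/eqP => [|->//].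
have wN : (weight I <= N)%N by rewrite /weight (leq_trans (max_card _)) ?card_ord.
have w0 : (0 < weight I)%N.
  rewrite lt0n weight_sum sum_nat_eq0; apply/negP => /forallP e.
  move: I0; rewrite !inE => /eqP; apply; apply/ffunP => j; rewrite ffunE.
  by have := e j; rewrite eqb0 negbK => /eqP.
move: (weight I) wN w0 => w wN w0.
have q' : 1 - q^-1 != 0 by rewrite subr_eq0 eq_sym; rewrite invr_eq1 gt_eqF.
move/oppr_inj/addrI/mulfI; rewrite mulf_neq0 ?pnatr_eq0 // => /(_ isT) e.
have : (w%:R - 1) * (3 * N%:R - 2 - 2 * w%:R) = 0 :> R by lra.
move=> /eqP; rewrite mulf_eq0 subr_eq0 pnatr_eq1 => /orP[/eqP//|].
have : 3 <= N%:R :> R by rewrite (ler_nat _ 3).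
have : w%:R <= N%:R :> R by rewrite ler_nat.
by move=> h1 h2 /eqP h3; exfalso; clear -h1 h2 h3; lra.
Qed.

End Count.

(** * Derivatives of curves of complex matrices *)

Section Velocity.
Context {R : realType}.

Lemma is_derive_diff (V W : normedModType R) (f : R -> V) (F : V -> W) (t : R) (v : V) :
  is_derive t (1 : R) f v -> differentiable F (f t) ->
  is_derive t (1 : R) (fun s => F (f s)) ('d F (f t) v).
Proof.
move=> [/derivable1_diffP df <-] dF.
have dFf := differentiable_comp df dF.
split; first exact/derivable1_diffP.
by rewrite deriveE // diff_comp //= deriveE.
Qed.

Lemma is_derive_lin (V W : normedModType R) (L : {linear V -> W}) (f : R -> V)
    (t : R) (v : V) :
  continuous L -> is_derive t (1 : R) f v ->
  is_derive t (1 : R) (fun s => L (f s)) (L v).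
Proof.
move=> cL df; have := is_derive_diff df (linear_differentiable (f t) cL).
by rewrite diff_lin.
Qed.

(** The derivative is taken on the real and imaginary parts, in accordance with
    [realify]. *)
Definition cder (f : R -> R[i]) (t : R) (z : R[i]) : Prop :=
  is_derive t (1 : R) (fun s => complex.Re (f s)) (complex.Re z) /\
  is_derive t (1 : R) (fun s => complex.Im (f s)) (complex.Im z).

Lemma cder_cst z t : cder (fun _ => z) t 0.
Proof. by split; apply: is_derive_cst. Qed.

Lemma cder_real (f : R -> R) (t l : R) :
  is_derive t (1 : R) f l -> cder (fun s => (f s)%:C) t l%:C.
Proof. by move=> df; split => //=; apply: is_derive_cst. Qed.

Lemma cderD f g t y z : cder f t y -> cder g t z -> cder (fun s => f s + g s) t (y + z).
Proof.
move=> [fr fi] [gr gi]; split; rewrite raddfD.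
  have -> : (fun s => complex.Re (f s + g s)) =
      (fun s => complex.Re (f s)) + (fun s => complex.Re (g s)).
    by apply/funext => s; rewrite raddfD.
  exact: is_deriveD.
have -> : (fun s => complex.Im (f s + g s)) =
    (fun s => complex.Im (f s)) + (fun s => complex.Im (g s)).
  by apply/funext => s; rewrite raddfD.
exact: is_deriveD.
Qed.

Lemma cderM f g t y z :
  cder f t y -> cder g t z -> cder (fun s => f s * g s) t (y * g t + f t * z).
Proof.
move=> [fr fi] [gr gi].
split.
  have -> : (fun s => complex.Re (f s * g s)) =
      (fun s => complex.Re (f s)) * (fun s => complex.Re (g s))
      - (fun s => complex.Im (f s)) * (fun s => complex.Im (g s)).
    by apply/funext => s; rewrite !fctE; case: (f s) (g s) => [? ?] [? ?].
  apply: (is_derive_eq (is_deriveB (is_deriveM fr gr) (is_deriveM fi gi))).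
  rewrite /GRing.scale /=.
  by case: (f t) (g t) y z {fr fi gr gi} => [? ?] [? ?] [? ?] [? ?] /=; ring.
have -> : (fun s => complex.Im (f s * g s)) =
    (fun s => complex.Re (f s)) * (fun s => complex.Im (g s))
    + (fun s => complex.Im (f s)) * (fun s => complex.Re (g s)).
  by apply/funext => s; rewrite !fctE; case: (f s) (g s) => [? ?] [? ?].
apply: (is_derive_eq (is_deriveD (is_deriveM fr gi) (is_deriveM fi gr))).
rewrite /GRing.scale /=.
by case: (f t) (g t) y z {fr fi gr gi} => [? ?] [? ?] [? ?] [? ?] /=; ring.
Qed.

Lemma cder_sum (T : Type) (r : seq T) (f : T -> R -> R[i]) t z :
  (forall k, cder (f k) t (z k)) ->
  cder (fun s => \sum_(k <- r) f k s) t (\sum_(k <- r) z k).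
Proof.
move=> df; elim: r => [|k r IH].
  rewrite big_nil; under [X in cder X]eq_fun do rewrite big_nil; exact: cder_cst.
rewrite big_cons; under [X in cder X]eq_fun do rewrite big_cons; exact: cderD.
Qed.

Lemma cder_conj f t z : cder f t z -> cder (fun s => (f s)^*) t (z^*).
Proof.
have conjE (w : R[i]) : w^* = (complex.Re w -i* complex.Im w)%C by case: w.
move=> [fr fi]; split.
  by rewrite conjE /=; under eq_fun do rewrite conjE /=.
rewrite conjE /=; under eq_fun do rewrite conjE /=.
exact: is_deriveN.
Qed.

Section Matrices.
Variable n : nat.
Implicit Types (f g : R -> 'M[R[i]]_n) (A B X Y : 'M[R[i]]_n).

Definition velocity f (t : R) A : Prop :=
  is_derive t (1 : R) (fun s => realify (f s)) (realify A).

Lemma realifyK : cancel (@realify R n) (@complexify R n).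
Proof. by move=> X; apply/matrixP => a b; rewrite !mxE /=; case: (X a b). Qed.

Lemma complexifyK : cancel (@complexify R n) (@realify R n).
Proof.
by move=> [u v]; congr pair; apply/matrixP => a b; rewrite !mxE.
Qed.

Lemma is_derive_entryP (f : R -> 'M[R]_n) (t : R) (A' : 'M[R]_n) :
  is_derive t (1 : R) f A' <->
  forall a b, is_derive t (1 : R) (fun s => f s a b) (A' a b).
Proof.
split=> [[df <-] a b|df].
  by split; [exact: (derivable_mxP _ _ _).1 | rewrite derive_mx // mxE].
have d : derivable f t 1 by apply/derivable_mxP => a b; have [] := df a b.
split => //; rewrite derive_mx //; apply/matrixP => a b; rewrite mxE.
by have [] := df a b.
Qed.

Lemma is_derive_pairP (V W : normedModType R) (f : R -> V * W) (t : R) u :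
  is_derive t (1 : R) f u <->
  is_derive t (1 : R) (fun s => (f s).1) u.1 /\
  is_derive t (1 : R) (fun s => (f s).2) u.2.
Proof.
have cfst : continuous (fst : V * W -> V) by move=> ?; exact: cvg_fst.
have csnd : continuous (snd : V * W -> W) by move=> ?; exact: cvg_snd.
split=> [df|[[d1 e1] [d2 e2]]].
  split; first exact: (is_derive_lin (L := fst) cfst df).
  exact: (is_derive_lin (L := snd) csnd df).
have {}d1 : differentiable (fun s => (f s).1) t by exact/derivable1_diffP.
have {}d2 : differentiable (fun s => (f s).2) t by exact/derivable1_diffP.
have fE : f = fun s => ((f s).1, (f s).2) by apply/funext => s; case: (f s).
have d : differentiable f t by rewrite fE; exact: differentiable_pair.
split; first exact/derivable1_diffP.
rewrite deriveE // {1}fE diff_pair // -!deriveE // e1 e2.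
by case: u {e1 e2}.
Qed.

(** Reduces matrix-valued curves to their entries, where the product rule can be
    checked by hand. *)
Lemma velocityP f t A :
  velocity f t A <-> forall a b, cder (fun s => f s a b) t (A a b).
Proof.
have re a b : (fun s => (realify (f s)).1 a b) = fun s => complex.Re (f s a b).
  by apply/funext => s; rewrite mxE.
have im a b : (fun s => (realify (f s)).2 a b) = fun s => complex.Im (f s a b).
  by apply/funext => s; rewrite mxE.
rewrite /velocity is_derive_pairP !is_derive_entryP.
split=> [[fr fi] a b|df].
  by have := fr a b; have := fi a b; rewrite !mxE re im; split.
by split=> a b; have [fr fi] := df a b; rewrite mxE ?re ?im.
Qed.

Lemma velocity_unique f t A B : velocity f t A -> velocity f t B -> A = B.
Proof.
by move=> [_ dA] [_ dB]; apply: (can_inj realifyK); rewrite -dA -dB.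
Qed.

Lemma velocity_cst X t : velocity (fun _ => X) t 0.
Proof. by apply/velocityP => a b; rewrite mxE; exact: cder_cst. Qed.

Lemma velocityM f g t A B : velocity f t A -> velocity g t B ->
  velocity (fun s => f s *m g s) t (A *m g t + f t *m B).
Proof.
move=> /velocityP df /velocityP dg; apply/velocityP => a b.
rewrite !mxE -big_split /=; under [X in cder X]eq_fun do rewrite mxE.
by apply: cder_sum => k; exact: cderM.
Qed.

Lemma velocity_adj f t A : velocity f t A -> velocity (fun s => (f s) ^t*) t (A ^t*).
Proof.
move=> /velocityP df; apply/velocityP => a b; rewrite !mxE.
under [X in cder X]eq_fun do rewrite !mxE; exact: cder_conj.
Qed.

Lemma velocityD f g t A B : velocity f t A -> velocity g t B ->
  velocity (fun s => f s + g s) t (A + B).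
Proof.
move=> /velocityP df /velocityP dg; apply/velocityP => a b; rewrite mxE.
by under [X in cder X]eq_fun do rewrite mxE; exact: cderD.
Qed.

Lemma velocityZ (c : R -> R) (l t : R) X : is_derive t (1 : R) c l ->
  velocity (fun s => (c s)%:C *: X) t (l%:C *: X).
Proof.
move=> dc; apply/velocityP => a b; rewrite mxE.
under [X in cder X]eq_fun do rewrite mxE.
by have := cderM (cder_real dc) (cder_cst (X a b) t); rewrite mulr0 addr0.
Qed.

End Matrices.
End Velocity.

(** * Curves in the special unitary group *)

Section Curves.
Context {R : realType}.

Lemma realify_linear n (a : R) (X Y : 'M[R[i]]_n) :
  realify (a%:C *: X + Y) = a *: realify X + realify Y.
Proof.
by congr pair; apply/matrixP => r s; rewrite !mxE /=;
  case: (X r s) (Y r s) => [? ?] [? ?] /=; ring.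
Qed.

(** [T] is the differential at [p] of a smooth extension of [h]. It depends on
    the extension, but on velocities of curves in SU(n) it computes the
    velocity of the image curve. The second property says that [T] is
    continuous, in the form in which it is used. *)
Lemma smooth_SU_linearization n (h : 'M[R[i]]_n -> 'M[R[i]]_n) p : SU p ->
  smooth_SU (fun p => realify (h p)) ->
  exists T : 'M[R[i]]_n -> 'M[R[i]]_n,
    [/\ forall a X Y, T (a%:C *: X + Y) = a%:C *: T X + T Y,
        forall f t A, velocity f t A -> velocity (fun s => T (f s)) t (T A) &
        forall c u, curve_with_velocity p u c -> velocity (fun s => h (c s)) 0 (T u)].
Proof.
move=> SUp /(_ (realify p)); rewrite /= realifyK => /(_ SUp)[U [F [oU Up CF FE]]].
have dF : differentiable F (realify p) by have [+ _] := CF 1%N; exact.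
exists (fun X => complexify ('d F (realify p) (realify X))); split.
- move=> a X Y; apply: (can_inj (@realifyK _ _)).
  by rewrite [in LHS]complexifyK [in LHS]realify_linear linearP realify_linear 2!complexifyK.
- move=> f t A df; rewrite /velocity complexifyK; under eq_fun do rewrite complexifyK.
  have cdF : continuous ('d F (realify p)) by exact: diff_continuous.
  exact: (is_derive_lin cdF df).
- move=> c u [SUc c0 dc]; subst p; rewrite /velocity complexifyK.
  have := is_derive_diff dc dF.
  apply: near_eq_is_derive.
  have [/derivable1_diffP/differentiable_continuous cc _] := dc.
  have nU : nbhs (realify (c 0)) U by exact: open_nbhs_nbhs.
  have cU : \forall t \near (0 : R), U (realify (c t)) by exact: cc.
  near=> t; have Ut : U (realify (c t)) by near: t.
  rewrite FE //= ?realifyK //; exact: SUc.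
Unshelve. all: by end_near. Qed.

Lemma adj_realZ n (a : R) (X : 'M[R[i]]_n) : (a%:C *: X) ^t* = a%:C *: X ^t*.
Proof. by rewrite linearZ /= map_mxZ; congr (_ *: _); exact: conjc_real. Qed.

Lemma SU_mul n (p p' : 'M[R[i]]_n) : SU p -> SU p' -> SU (p *m p').
Proof.
move=> [up dp] [up' dp']; split; first exact: mul_unitarymx.
by rewrite det_mulmx dp dp' mulr1.
Qed.

Lemma SU1 n : SU (1%:M : 'M[R[i]]_n).
Proof.
by split; [apply/unitarymxP; rewrite mul1mx trmx1 map_mx1 | exact: det1].
Qed.

Lemma SU_adj n (p : 'M[R[i]]_n) : SU p -> SU (p ^t*).
Proof.
move=> [up dp]; split; first by rewrite trmxC_unitary.
by rewrite det_map_mx det_tr dp rmorph1.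
Qed.

Lemma SU_mulV n (p : 'M[R[i]]_n) : SU p -> p *m p ^t* = 1%:M.
Proof. by move=> [/unitarymxP]. Qed.

Lemma SU_mulVr n (p : 'M[R[i]]_n) : SU p -> p ^t* *m p = 1%:M.
Proof. by move=> /SU_mulV; exact: mulmx1C. Qed.

Variable N : nat.
Implicit Types I J K : {ffun 'I_N -> 'I_4}.
Local Notation st := (@sigma_tilde R N).

(** The one-parameter group [exp (t *: sigma_tilde I)], explicit because
    [sigma_tilde I] squares to [-1]. *)
Definition pauli_rotation I (t : R) : 'M[R[i]]_(2 ^ N) :=
  (cos t)%:C *: 1%:M + (sin t)%:C *: st I.

Lemma pauli_rotationD I s t :
  pauli_rotation I s *m pauli_rotation I t = pauli_rotation I (s + t).
Proof.
rewrite /pauli_rotation cosD sinD; have := @sigma_tilde_sqr R N I.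
move: (st I) => S SS; rewrite mulmxDl !mulmxDr -!scalemxAl -!scalemxAr.
rewrite !mul1mx !mulmx1 SS rmorphB rmorphD !(rmorphM (real_complex R)) /=.
move: (cos s)%:C (cos t)%:C (sin s)%:C (sin t)%:C => cs ct ss st'.
apply/matrixP => a b; rewrite !mxE.
by move: (S a b) (_%:R) => *; ring.
Qed.

Lemma pauli_rotation_adj I t : (pauli_rotation I t) ^t* = pauli_rotation I (- t).
Proof.
rewrite /pauli_rotation cosN sinN; have := @sigma_tilde_adj R N I.
move: (st I) => S SS; rewrite linearD /= map_mxD !adj_realZ.
by rewrite trmx1 map_mx1 SS rmorphN /= scaleNr scalerN.
Qed.

(** An anticommuting partner conjugates the rotation by [t] into the rotation by
    [- t], its inverse; so the determinant is its own inverse. It is therefore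
    1, since the rotation by [t] is the square of the rotation by [t / 2]. *)
Lemma pauli_rotation_SU I t : I \in multi_index0 N -> SU (pauli_rotation I t).
Proof.
move=> I0.
have rotV u : pauli_rotation I u *m pauli_rotation I (- u) = 1%:M.
  by rewrite pauli_rotationD subrr /pauli_rotation cos0 sin0 scale1r scale0r addr0.
split; first by apply/unitarymxP; rewrite pauli_rotation_adj.
have [J _ IJ] := @anticommuting_partner R _ _ I0.
have detN u : \det (pauli_rotation I u) = \det (pauli_rotation I (- u)).
  have e : pauli_rotation I u *m st J = st J *m pauli_rotation I (- u).
    have := @sigma_tilde_comm R N I J; rewrite IJ /pauli_rotation cosN sinN.
    move: (st I) (st J) => S S' SS'.
    rewrite mulmxDl mulmxDr -!scalemxAl -!scalemxAr mul1mx mulmx1.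
    by rewrite SS' scalerA -rmorphM mulrN1.
  have : \det (st J) * \det (st J) != 0.
    by rewrite -det_mulmx sigma_tilde_sqr -scaleN1r detZ det1 mulr1 expf_neq0.
  rewrite mulf_eq0 orbb => nz; apply: (mulIf nz).
  rewrite -det_mulmx e det_mulmx; exact: mulrC.
have -> : t = t / 2 + t / 2 by field.
by rewrite -pauli_rotationD det_mulmx {2}detN -det_mulmx rotV det1.
Qed.

(** The product of the rotations at speeds [x I] has at 0 the velocity
    [\sum_I (x I)%:C *: sigma_tilde I]. *)
Lemma su_curve (X : 'M[R[i]]_(2 ^ N)) : su X ->
  exists c, curve_with_velocity 1%:M X c.
Proof.
move=> /su_spanned[x ->]; rewrite -big_filter.
have : all [in multi_index0 N] [seq I <- index_enum _ | I \in multi_index0 N].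
  exact: filter_all.
elim: [seq I <- _ | _] => [|I r IH] /=.
  move=> _; exists (fun=> 1%:M); split=> //; first by move=> _; exact: SU1.
  by rewrite big_nil; exact: velocity_cst.
move=> /andP[I0 /IH[c [cSU c0 dc]]].
have rot0 : pauli_rotation I (x I * 0) = 1%:M.
  by rewrite mulr0 /pauli_rotation cos0 sin0 scale1r scale0r addr0.
exists (fun t => pauli_rotation I (x I * t) *m c t); split.
- by move=> t; apply: SU_mul => //; exact: pauli_rotation_SU.
- by rewrite c0 rot0 mul1mx.
- rewrite big_cons.
  have dl : is_derive (0 : R) (1 : R) (fun t => x I * t) (x I).
    apply: (is_derive_eq (is_deriveZ (x I) (is_derive_id _ _))).
    by rewrite /GRing.scale /= mulr1.
  have dcos : is_derive (0 : R) (1 : R) (fun t => cos (x I * t)) 0.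
    by apply: (is_derive_eq (is_derive1_comp _ dl)); rewrite mulr0 sin0 oppr0 mul0r.
  have dsin : is_derive (0 : R) (1 : R) (fun t => sin (x I * t)) (x I).
    by apply: (is_derive_eq (is_derive1_comp _ dl)); rewrite mulr0 cos0 mul1r.
  have := velocityM (velocityD (velocityZ 1%:M dcos) (velocityZ (st I) dsin)) dc.
  by rewrite -/(pauli_rotation I (x I * 0)) rot0 c0 mul1mx mulmx1 scale0r add0r.
Qed.

End Curves.

(** * Brackets *)

Definition lie_bracket (R : realType) n (X Y : 'M[R[i]]_n) := X *m Y - Y *m X.

Section Brackets.
Context {R : realType}.
Variable n : nat.
Implicit Types X Y Z : 'M[R[i]]_n.

Lemma suZD (a : R) X Y : su X -> su Y -> su (a%:C *: X + Y).
Proof.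
move=> [aX tX] [aY tY]; split; last by rewrite mxtraceD mxtraceZ tX tY mulr0 addr0.
by rewrite linearD /= map_mxD adj_realZ aX aY opprD scalerN.
Qed.

Lemma su0 : su (0 : 'M[R[i]]_n).
Proof. by split; rewrite ?trmx0 ?map_mx0 ?oppr0 ?mxtrace0. Qed.

Lemma su_lie_bracket X Y : su X -> su Y -> su (lie_bracket X Y).
Proof.
move=> [aX tX] [aY tY]; split.
  rewrite /lie_bracket linearB /= map_mxB !trmx_mul !map_mxM /= aX aY.
  by rewrite !mulmxN !mulNmx !opprK opprB.
by rewrite /lie_bracket linearB /= [X in _ - X]mxtrace_mulC subrr.
Qed.

Lemma su_sum (I : Type) (r : seq I) (P : pred I) (a : I -> R) (F : I -> 'M[R[i]]_n) :
  (forall k, P k -> su (F k)) -> su (\sum_(k <- r | P k) (a k)%:C *: F k).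
Proof.
move=> suF; elim: r => [|k r IH]; first by rewrite big_nil; exact: su0.
by rewrite big_cons; case: ifP => // Pk; apply: suZD => //; exact: suF.
Qed.

Lemma lie_bracketDr X Y Z : lie_bracket X (Y + Z) = lie_bracket X Y + lie_bracket X Z.
Proof. by rewrite /lie_bracket mulmxDl mulmxDr opprD addrACA. Qed.

Lemma lie_bracketZr c X Y : lie_bracket X (c *: Y) = c *: lie_bracket X Y.
Proof. by rewrite /lie_bracket -scalemxAl -scalemxAr scalerBr. Qed.

Lemma lie_bracketDl X Y Z : lie_bracket (X + Y) Z = lie_bracket X Z + lie_bracket Y Z.
Proof. by rewrite /lie_bracket mulmxDl mulmxDr opprD addrACA. Qed.

Lemma lie_bracketZl c X Y : lie_bracket (c *: X) Y = c *: lie_bracket X Y.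
Proof. by rewrite /lie_bracket -scalemxAl -scalemxAr scalerBr. Qed.

Lemma lie_bracket_suml (I : Type) (r : seq I) (P : pred I) (F : I -> 'M[R[i]]_n) X :
  lie_bracket (\sum_(k <- r | P k) F k) X = \sum_(k <- r | P k) lie_bracket (F k) X.
Proof.
apply: (big_morph (fun Y => lie_bracket Y X)) => [? ?|]; first exact: lie_bracketDl.
by rewrite /lie_bracket mulmx0 mul0mx subrr.
Qed.

Lemma lie_bracket_sumr (I : Type) (r : seq I) (P : pred I) (F : I -> 'M[R[i]]_n) X :
  lie_bracket X (\sum_(k <- r | P k) F k) = \sum_(k <- r | P k) lie_bracket X (F k).
Proof.
apply: (big_morph (lie_bracket X)) => [? ?|]; first exact: lie_bracketDr.
by rewrite /lie_bracket mulmx0 mul0mx subrr.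
Qed.

End Brackets.

(** * The differential of an automorphism at the identity *)

Section Automorphisms.
Context {R : realType}.
Variable N : nat.
Implicit Types (X Y : 'M[R[i]]_(2 ^ N)) (h : 'M[R[i]]_(2 ^ N) -> 'M[R[i]]_(2 ^ N)).
Local Notation st := (@sigma_tilde R N).

(** Up to the sign [s], the two matrices commute, and [sigma_tilde K] squares to
    [-1]; the four terms of the double bracket are [- 1], [s], [s] and [- 1]
    times [sigma_tilde J]. *)
Lemma double_bracket_sigma_tilde K J :
  lie_bracket (st K) (lie_bracket (st K) (st J)) =
  (2 * (index_sign K J - 1))%:C *: st J.
Proof.
have := @sigma_tilde_comm R N K J; have := @sigma_tilde_sqr R N K.
move: (st K) (st J) (index_sign K J) => S T s SS ST.
have e1 : S *m (S *m T) = - T by rewrite mulmxA SS mulNmx mul1mx.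
have e2 : T *m S *m S = - T by rewrite -mulmxA SS mulmxN mulmx1.
have e3 : S *m (T *m S) = - (s%:C *: T).
  by rewrite mulmxA ST -scalemxAl e2 scalerN.
rewrite /lie_bracket mulmxBr mulmxBl e1 e2 e3 -mulmxA e3.
rewrite rmorphM rmorphB rmorph1 rmorph_nat.
apply/matrixP => a b; rewrite !mxE; ring.
Qed.

Lemma automorphism1 h : lie_group_automorphism h -> h 1%:M = 1%:M.
Proof.
move=> [hSU hM _ _]; have SU1 := @SU1 R (2 ^ N).
have e : h 1%:M *m h 1%:M = h 1%:M by rewrite -hM // mul1mx.
have := congr1 (mulmx ((h 1%:M) ^t*)) e.
by rewrite mulmxA SU_mulVr ?mul1mx //; exact: hSU.
Qed.

Lemma automorphism_adj h p : lie_group_automorphism h -> SU p ->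
  h (p ^t*) = (h p) ^t*.
Proof.
move=> ah SUp; have [hSU hM _ _] := ah.
have e : h p *m h (p ^t*) = 1%:M.
  by rewrite -hM //; [rewrite SU_mulV // automorphism1 | exact: SU_adj].
have := congr1 (mulmx ((h p) ^t*)) e.
by rewrite mulmxA SU_mulVr ?mul1mx ?mulmx1 //; exact: hSU.
Qed.

(** The differential is only specified through curves; since every element of su
    is the velocity of one, it agrees there with any linearization of [h]. *)
Lemma differential_linearization h : lie_group_automorphism h ->
  exists T : 'M[R[i]]_(2 ^ N) -> 'M[R[i]]_(2 ^ N),
    [/\ forall a X Y, T (a%:C *: X + Y) = a%:C *: T X + T Y,
        forall f t A, velocity f t A -> velocity (fun s => T (f s)) t (T A),
        forall c u, curve_with_velocity 1%:M u c -> velocity (fun s => h (c s)) 0 (T u) &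
        forall X, su X -> differential h 1%:M X = T X].
Proof.
move=> [_ _ hsm _]; have [T [T1 T2 T3]] := smooth_SU_linearization (@SU1 R _) hsm.
exists T; split => // X /su_curve[c cX].
rewrite /differential; set P := [set w | _].
have PT : P (T X) by move=> c'; exact: T3.
have /(_ c cX) := xgetPex 0 (ex_intro P _ PT).
by move/velocity_unique; apply; exact: T3.
Qed.

Lemma differential_curve h c X : lie_group_automorphism h -> su X ->
  curve_with_velocity 1%:M X c -> velocity (fun s => h (c s)) 0 (differential h 1%:M X).
Proof.
move=> /differential_linearization[T [_ _ T3 T4]] suX cX.
by rewrite T4 //; exact: T3.
Qed.

Lemma differential_linear h a X Y : lie_group_automorphism h -> su X -> su Y ->
  differential h 1%:M (a%:C *: X + Y) =
  a%:C *: differential h 1%:M X + differential h 1%:M Y.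
Proof.
move=> /differential_linearization[T [T1 _ _ T4]] suX suY.
by rewrite !T4 //; exact: suZD.
Qed.

Lemma differential0 h : lie_group_automorphism h -> differential h 1%:M 0 = 0.
Proof.
move=> ah; have := differential_linear (-1) ah (su0 _) (su0 _).
by rewrite scaler0 addr0 rmorphN1 scaleN1r addNr.
Qed.

Lemma differentialZ h a X : lie_group_automorphism h -> su X ->
  differential h 1%:M (a%:C *: X) = a%:C *: differential h 1%:M X.
Proof.
move=> ah suX; have := differential_linear a ah suX (su0 _).
by rewrite differential0 // !addr0.
Qed.

(** Differentiate [h (c s) *m (h (c s)) ^t* = 1]. *)
Lemma differential_skew h X : lie_group_automorphism h -> su X ->
  (differential h 1%:M X) ^t* = - differential h 1%:M X.
Proof.
move=> ah suX; have [c cX] := su_curve suX.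
have dhc := differential_curve ah suX cX; have [cSU c0 _] := cX.
have [hSU _ _ _] := ah.
have := velocityM dhc (velocity_adj dhc).
rewrite c0 automorphism1 // trmx1 map_mx1 mulmx1 mul1mx => d1.
have d0 : velocity (fun s => h (c s) *m (h (c s)) ^t*) 0 0.
  rewrite (_ : (fun s => _) = fun=> 1%:M); first exact: velocity_cst.
  by apply/funext => s; rewrite SU_mulV //; exact: hSU.
by apply/eqP; rewrite -addr_eq0 addrC; apply/eqP; exact: velocity_unique d1 d0.
Qed.

Lemma differential_conj h p X : lie_group_automorphism h -> SU p -> su X ->
  su (p *m X *m p ^t*) ->
  differential h 1%:M (p *m X *m p ^t*) = h p *m differential h 1%:M X *m (h p) ^t*.
Proof.
move=> ah SUp suX suY; have [c cX] := su_curve suX.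
have [cSU c0 dc] := cX; have [hSU hM _ _] := ah; have SUp' := SU_adj SUp.
have sandwich f A (q : 'M[R[i]]_(2 ^ N)) : velocity f 0 A ->
    velocity (fun s => q *m f s *m q ^t*) 0 (q *m A *m q ^t*).
  move=> df; have := velocityM (velocityM (velocity_cst q 0) df) (velocity_cst (q ^t*) 0).
  by rewrite mul0mx add0r mulmx0 addr0.
have cY : curve_with_velocity 1%:M (p *m X *m p ^t*) (fun s => p *m c s *m p ^t*).
  split; [|by rewrite c0 mulmx1 SU_mulV|exact: sandwich].
  by move=> t; do !apply: SU_mul => //.
have dhY := differential_curve ah suY cY.
apply: (velocity_unique dhY).
have hcE : (fun s => h (p *m c s *m p ^t*)) = fun s => h p *m h (c s) *m (h p) ^t*.
  apply/funext => s; rewrite hM //; last exact: SU_mul.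
  by rewrite hM // automorphism_adj.
rewrite hcE; exact: (sandwich _ _ _ (differential_curve ah suX cX)).
Qed.


(** Differentiate [differential_conj] along a curve [p = c s] with velocity [X]:
    both sides are conjugates of a fixed matrix by a unitary curve through the
    identity, whose velocity is a bracket. *)
Lemma differential_lie_bracket h X Y : lie_group_automorphism h -> su X -> su Y ->
  differential h 1%:M (lie_bracket X Y) =
  lie_bracket (differential h 1%:M X) (differential h 1%:M Y).
Proof.
move=> ah suX suY; have [c cX] := su_curve suX; have [cSU c0 dc] := cX.
have [T [_ T2 _ T4]] := differential_linearization ah.
have suconj s : su (c s *m Y *m (c s) ^t*).
  have [aY tY] := suY; split.
    by rewrite !trmx_mul !map_mxM /= trmxCK aY mulNmx mulmxN mulmxA.
  by rewrite mxtrace_mulC mulmxA SU_mulVr // mul1mx.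
have conj_velocity (f : R -> 'M[R[i]]_(2 ^ N)) A Z :
    velocity f 0 A -> f 0 = 1%:M -> A ^t* = - A ->
    velocity (fun s => f s *m Z *m (f s) ^t*) 0 (lie_bracket A Z).
  move=> df f0 aA.
  have := velocityM (velocityM df (velocity_cst Z 0)) (velocity_adj df).
  by rewrite f0 trmx1 map_mx1 !mulmx1 !mul1mx addr0 aA mulmxN.
have d1 := T2 _ _ _ (conj_velocity _ _ Y dc c0 suX.1).
have dh0 : h (c 0) = 1%:M by rewrite c0 automorphism1.
have d2 := conj_velocity _ _ (differential h 1%:M Y) (differential_curve ah suX cX)
  dh0 (differential_skew ah suX).
rewrite T4; last exact: su_lie_bracket.
apply: velocity_unique d1 _.
have hcE : (fun s => T (c s *m Y *m (c s) ^t*)) =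
    fun s => h (c s) *m differential h 1%:M Y *m (h (c s)) ^t*.
  by apply/funext => s; rewrite -T4 // differential_conj.
by rewrite hcE.
Qed.

Lemma differential_sum h (x : {ffun 'I_N -> 'I_4} -> R) (P : pred {ffun 'I_N -> 'I_4})
    (F : {ffun 'I_N -> 'I_4} -> 'M[R[i]]_(2 ^ N)) :
  lie_group_automorphism h -> (forall I, P I -> su (F I)) ->
  differential h 1%:M (\sum_(I | P I) (x I)%:C *: F I) =
  \sum_(I | P I) (x I)%:C *: differential h 1%:M (F I).
Proof.
move=> ah suF; have [T [T1 _ _ T4]] := differential_linearization ah.
have T0 : T 0 = 0 by rewrite -T4 ?differential0 //; exact: su0.
rewrite T4; last exact: su_sum.
rewrite [RHS](eq_bigr (fun I => (x I)%:C *: T (F I))); last first.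
  by move=> I /suF suFI; rewrite T4.
elim: (index_enum _) => [|I r IH]; first by rewrite !big_nil.
by rewrite !big_cons; case: ifP => // _; rewrite T1 IH.
Qed.

(** Each [sigma_tilde I] is a multiple of a double bracket, so its image is a
    multiple of a bracket and has trace 0. *)
Lemma differential_su h X : lie_group_automorphism h -> su X ->
  su (differential h 1%:M X).
Proof.
move=> ah suX; split; first exact: differential_skew.
have [x ->] := su_spanned suX; rewrite differential_sum //; last exact: su_sigma_tilde.
rewrite raddf_sum /= big1 // => I I0; rewrite mxtraceZ.
have [J J0 IJ] := @anticommuting_partner R _ _ I0.
have suJ := @su_sigma_tilde R _ _ J0; have suI := @su_sigma_tilde R _ _ I0.
have e := double_bracket_sigma_tilde J I; rewrite index_signC IJ in e.
have eI : st I = (- 4^-1)%:C *: lie_bracket (st J) (lie_bracket (st J) (st I)).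
  by rewrite e scalerA -rmorphM /= (_ : _ * _ = 1) ?scale1r //; field.
rewrite eI differentialZ //; last by do !apply: su_lie_bracket.
rewrite differential_lie_bracket //; last exact: su_lie_bracket.
rewrite mxtraceZ /lie_bracket raddfB /= [X in _ - X]mxtrace_mulC subrr.
by rewrite !mulr0.
Qed.

(** If [c] has velocity [X], then [h' \o c] has velocity [differential h' 1 X], and
    applying [h] to it gives [c] back. *)
Lemma differentialK h h' X : lie_group_automorphism h -> lie_group_automorphism h' ->
  (forall p, SU p -> h (h' p) = p) -> su X ->
  differential h 1%:M (differential h' 1%:M X) = X.
Proof.
move=> ah ah' hh' suX; have [c cX] := su_curve suX; have [cSU c0 dc] := cX.
have cY : curve_with_velocity 1%:M (differential h' 1%:M X) (fun s => h' (c s)).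
  split; [|by rewrite c0 automorphism1|exact: differential_curve cX].
  by move=> t; have [h'SU _ _ _] := ah'; exact: h'SU.
have d := differential_curve ah (differential_su ah' suX) cY.
apply: velocity_unique d _.
have -> // : (fun s => h (h' (c s))) = c by apply/funext => s; rewrite hh'.
Qed.

Lemma automorphism_inverse h : lie_group_automorphism h -> exists h',
  [/\ lie_group_automorphism h', forall p, SU p -> h' (h p) = p &
      forall p, SU p -> h (h' p) = p].
Proof.
move=> [hSU hM hsm [h' [h'SU h'h hh' h'sm]]]; exists h'; split => //.
split => //; last by exists h.
move=> p p' SUp SUp'.
rewrite -[LHS]h'h; last by apply: h'SU; exact: SU_mul.
rewrite hh'; last exact: SU_mul.
rewrite -{1}(hh' p) // -{1}(hh' p') // -hM; try exact: h'SU.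
by rewrite h'h //; apply: SU_mul; exact: h'SU.
Qed.

End Automorphisms.

(** * The Casimir operator of the cliff metric *)

Section Casimir.
Context {R : realType}.
Variables (N : nat) (q : R).
Variable g : 'M[R[i]]_(2 ^ N) -> 'M[R[i]]_(2 ^ N) -> 'M[R[i]]_(2 ^ N) -> R.
Hypothesis q1 : 1 < q.
Hypothesis hg : cliff_metric q g.
Implicit Types (X Y Z : 'M[R[i]]_(2 ^ N)) (I J K : {ffun 'I_N -> 'I_4}).
Local Notation st := (@sigma_tilde R N).
Local Notation index0 := (multi_index0 N).
Local Notation G := (g 1%:M).
Local Notation gw K := (cliff_factors q (weight K)).

Lemma tangent_space1 X : su X -> tangent_space 1%:M X.
Proof. by move=> suX; exists X; rewrite ?mulmx1. Qed.

Lemma cliff_factors_gt0 k : 0 < cliff_factors q k.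
Proof. by rewrite /cliff_factors; case: ifP => // _; exact: lt_trans ltr01 q1. Qed.

Lemma metric1C X Y : su X -> su Y -> G X Y = G Y X.
Proof.
move=> /tangent_space1 tX /tangent_space1 tY; have [_ rg _ _] := hg.
exact: (Defs.metric_sym rg (@SU1 R _) tX tY).
Qed.

Lemma metric1_linear a X Y Z : su X -> su Y -> su Z ->
  G (a%:C *: X + Y) Z = a * G X Z + G Y Z.
Proof.
move=> /tangent_space1 tX /tangent_space1 tY /tangent_space1 tZ.
have [_ rg _ _] := hg; exact: (Defs.metric_linear rg a (@SU1 R _) tX tY tZ).
Qed.

Lemma metric1_sum (x : {ffun 'I_N -> 'I_4} -> R) (P : pred {ffun 'I_N -> 'I_4})
    (F : {ffun 'I_N -> 'I_4} -> 'M[R[i]]_(2 ^ N)) Z :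
  (forall I, P I -> su (F I)) -> su Z ->
  G (\sum_(I | P I) (x I)%:C *: F I) Z = \sum_(I | P I) x I * G (F I) Z.
Proof.
move=> suF suZ.
have G0 : G 0 Z = 0.
  have := metric1_linear 1 (su0 _) (su0 _) suZ; rewrite scaler0 addr0 mul1r => /eqP.
  by rewrite -subr_eq0 opprD addNKr oppr_eq0 => /eqP.
elim: (index_enum _) => [|I r IH]; first by rewrite !big_nil.
rewrite !big_cons; case: ifP => // PI; rewrite metric1_linear ?IH //; first exact: suF.
exact: su_sum.
Qed.

Lemma metric1_coord (x : {ffun 'I_N -> 'I_4} -> R) J : J \in index0 ->
  G (\sum_(I in index0) (x I)%:C *: st I) (st J) = x J * gw J.
Proof.
move=> J0; have [_ _ _ gst] := hg.
rewrite metric1_sum; [|by move=> I; exact: su_sigma_tilde|exact: su_sigma_tilde].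
rewrite (bigD1 J) //= gst // eqxx big1 ?addr0 // => I /andP[I0 /negbTE IJ].
by rewrite gst // IJ mulr0.
Qed.

(** The Parseval expansion in [e]. As [e] has as many members as su has
    dimensions, this says that [e] is a [g]-orthogonal basis with the norms of
    the Pauli basis, in the form which the Casimir operator needs. *)
Definition resolves_identity (e : {ffun 'I_N -> 'I_4} -> 'M[R[i]]_(2 ^ N)) :=
  (forall K, K \in index0 -> su (e K)) /\
  forall X, su X -> X = \sum_(K in index0) ((gw K)^-1 * G X (e K))%:C *: e K.

Lemma sigma_tilde_resolves : resolves_identity st.
Proof.
split=> [K|X suX]; first exact: su_sigma_tilde.
have [x Xe] := su_spanned suX.
have coord K : K \in index0 -> G X (st K) = x K * gw K.
  by rewrite Xe; exact: metric1_coord.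
rewrite {1}Xe; apply: eq_bigr => K K0; rewrite coord // mulrCA mulVf ?mulr1 //.
by rewrite gt_eqF // cliff_factors_gt0.
Qed.

Definition casimir (e : {ffun 'I_N -> 'I_4} -> 'M[R[i]]_(2 ^ N)) X :=
  \sum_(K in index0) ((gw K)^-1)%:C *: lie_bracket (e K) (lie_bracket (e K) X).

(** Expand the outer [e K] in the family [e'], exchange the sums, and recognise
    the expansion of [e' J] in the family [e]. *)
Lemma casimir_independent e e' X :
  resolves_identity e -> resolves_identity e' -> casimir e X = casimir e' X.
Proof.
move=> [sue re] [sue' re'].
transitivity (\sum_(K in index0) \sum_(J in index0)
   ((gw K)^-1 * (gw J)^-1 * G (e K) (e' J))%:C *:
     lie_bracket (e K) (lie_bracket (e' J) X)).
  apply: eq_bigr => K K0.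
  rewrite {2}(re' (e K)); last exact: sue.
  rewrite lie_bracket_suml lie_bracket_sumr scaler_sumr; apply: eq_bigr => J J0.
  by rewrite lie_bracketZl lie_bracketZr scalerA -rmorphM mulrA.
rewrite exchange_big; apply: eq_bigr => J J0 /=.
rewrite [X in _ = _ *: lie_bracket X _](re (e' J)); last exact: sue'.
rewrite lie_bracket_suml scaler_sumr; apply: eq_bigr => K K0.
rewrite lie_bracketZl scalerA -rmorphM mulrA [in RHS]metric1C; [|exact: sue'|exact: sue].
by rewrite [(gw J)^-1 * _]mulrC.
Qed.

Lemma casimir_sum (x : {ffun 'I_N -> 'I_4} -> R) (P : pred {ffun 'I_N -> 'I_4}) :
  casimir st (\sum_(I | P I) (x I)%:C *: st I) =
  \sum_(I | P I) (x I * casimir_eigenvalue q I)%:C *: st I.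
Proof.
rewrite /casimir; under eq_bigr do rewrite !lie_bracket_sumr scaler_sumr.
rewrite exchange_big /=; apply: eq_bigr => I _.
rewrite /casimir_eigenvalue mulr_sumr rmorph_sum scaler_suml; apply: eq_bigr => K _.
rewrite !(lie_bracketZr (x I)%:C) double_bracket_sigma_tilde.
move: (st I) => S; rewrite !scalerA -!rmorphM /=; congr (_%:C *: _).
by rewrite [RHS]mulrCA mulrA.
Qed.

(** By [casimir_eigenvalue_weight1], the eigenvalue of [sigma_tilde I] equals that
    of [sigma_tilde I1] only if [I] has weight 1, so the other coordinates of an
    eigenvector vanish. *)
Lemma W1_eigenspaceP I1 X : (3 <= N)%N -> I1 \in index0 -> weight I1 = 1%N ->
  W1 X <-> su X /\ casimir st X = (casimir_eigenvalue q I1)%:C *: X.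
Proof.
move=> N3 I10 w1; split=> [[a ->]|[suX]].
  split; first by apply: su_sum => I /andP[I0 _]; exact: su_sigma_tilde.
  rewrite casimir_sum scaler_sumr; apply: eq_bigr => I /andP[I0 wI].
  have /eqP -> : casimir_eigenvalue q I == casimir_eigenvalue q I1 :> R.
    by rewrite casimir_eigenvalue_weight1.
  by rewrite scalerA -rmorphM mulrC.
have [x Xe] := su_spanned suX => eX; exists x.
rewrite {1}Xe [LHS](bigID (fun I => weight I == 1%N)) /= [X in _ + X]big1 ?addr0 //.
move=> J /andP[J0 wJ].
have := congr1 (G^~ (st J)) eX.
rewrite {1}Xe casimir_sum metric1_coord // Xe scaler_sumr.
under eq_bigr do rewrite scalerA -rmorphM.
rewrite metric1_coord // => /mulIf; rewrite gt_eqF ?cliff_factors_gt0 // => /(_ isT) /eqP.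
rewrite [X in _ == X]mulrC -subr_eq0 -mulrBr mulf_eq0 subr_eq0.
by rewrite casimir_eigenvalue_weight1 // (negbTE wJ) orbF => /eqP ->; rewrite scale0r.
Qed.

(** An isometry maps the Parseval expansion of [Y] to one of [D Y], and every
    element of su is of the form [D Y]. *)
Lemma differential_resolves h : Aut_SU g h ->
  resolves_identity (fun K => differential h 1%:M (st K)).
Proof.
move=> [ah isoh]; split=> [K K0|X suX].
  by apply: differential_su => //; exact: su_sigma_tilde.
have [h' [ah' _ hh']] := automorphism_inverse ah.
rewrite -{1}(differentialK ah ah' hh' suX).
have suY := differential_su ah' suX.
have [_ resY] := sigma_tilde_resolves; rewrite {1}(resY _ suY).
rewrite differential_sum //; last exact: su_sigma_tilde.
apply: eq_bigr => K K0; congr (_%:C *: _); congr (_ * _).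
have suK := @su_sigma_tilde R _ _ K0.
have := isoh _ _ _ (@SU1 R _) (tangent_space1 suY) (tangent_space1 suK).
by rewrite automorphism1 // (differentialK ah ah' hh' suX).
Qed.

Lemma casimir_differential h X : Aut_SU g h -> su X ->
  casimir st (differential h 1%:M X) = differential h 1%:M (casimir st X).
Proof.
move=> Ah suX; have [ah _] := Ah.
have suD K : K \in index0 -> su (st K) by exact: su_sigma_tilde.
rewrite (casimir_independent _ sigma_tilde_resolves (differential_resolves Ah)).
rewrite /casimir differential_sum //; last first.
  by move=> K K0; do 2![apply: su_lie_bracket; [exact: suD|]].
apply: eq_bigr => K /suD suK; rewrite !differential_lie_bracket //.
exact: su_lie_bracket.
Qed.

End Casimir.


Theorem proposition3p10 (R : realType) (N : nat) (q : R)
    (hN : (3 <= N)%N) (hq : 1 < q)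
    (g : 'M[R[i]]_(2 ^ N) -> 'M[R[i]]_(2 ^ N) -> 'M[R[i]]_(2 ^ N) -> R)
    (hg : cliff_metric q g)
    (h : 'M[R[i]]_(2 ^ N) -> 'M[R[i]]_(2 ^ N)) (hh : Aut_SU g h) :
  [set differential h 1%:M X | X in @W1 R N] = @W1 R N.
Proof.
have [ah _] := hh; have [h' [ah' h'h hh']] := automorphism_inverse ah.
pose j0 : 'I_N := Ordinal (ltnW (ltnW hN)).
pose I1 : {ffun 'I_N -> 'I_4} := [ffun j => if j == j0 then inord 1 else ord0].
have w1 : weight I1 = 1%N.
  rewrite weight_sum (bigD1 j0) //= big1 => [|j /negbTE jn].
    by rewrite ffunE eqxx -val_eqE /= inordK.
  by rewrite ffunE jn eqxx.
have I10 : I1 \in multi_index0 N.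
  rewrite !inE; apply/eqP => e; move: w1; rewrite e weight_sum big1 // => j _.
  by rewrite ffunE eqxx.
have WP X := W1_eigenspaceP hq hg X hN I10 w1.
apply/seteqP; split=> [_ [X /WP[suX LX] <-]|Y /WP[suY LY]].
  apply/WP; split; first exact: differential_su.
  by rewrite (casimir_differential hq hg) // LX differentialZ.
(* Surjectivity: the preimage of an eigenvector is an eigenvector, because the
   differential of [h] is injective and commutes with the Casimir operator. *)
have suX := differential_su ah' suY.
exists (differential h' 1%:M Y); last exact: differentialK.
apply/WP; split => //.
have suLX : su (casimir q (@sigma_tilde R N) (differential h' 1%:M Y)).
  apply: su_sum => K K0; have suK := @su_sigma_tilde R _ _ K0.
  by do 2!apply: su_lie_bracket => //.
have suZX : su ((casimir_eigenvalue q I1)%:C *: differential h' 1%:M Y).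
  by rewrite -[_ *: _]addr0; apply: suZD => //; exact: su0.
rewrite -(differentialK ah' ah h'h suLX) -(differentialK ah' ah h'h suZX).
rewrite -(casimir_differential hq hg) // differentialZ //.
by rewrite (differentialK ah ah' hh' suY) LY.
Qed.
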